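(* The functor $(\_)^{\mathrm{cm}}:\mathbb{CA}\to\mathbb{CM}$ (from the category of clone algebras to the category of cm-monoids) is left adjoint to the functor $(\_)^{\mathrm{ca}}:\mathbb{CM}\to\mathbb{CA}$.
   Context: $S_\omega$ is the group of permutations $\sigma$ of $\omega$ with $\{n:\sigma(n)\neq n\}$ finite; such $\sigma$ is a permutation of $k=\{0,\dots,k-1\}$ if $\{n:\sigma(n)\ne n\}\subseteq k$. $\iota$ is the identity, $\tau^n_0$ is the transposition exchanging $0$ and $n$, and $\sigma_i=\sigma(i)$. A \emph{merge algebra} is $\mathbf A=(A,\star_n,\bar\sigma)_{n\in\omega,\sigma\in S_\omega}$ with $\star_n$ binary and $\bar\sigma$ unary such that: (B1) each $(A,\star_n)$ is an idempotent semigroup; (B2) $x\star_0y=y$; (B3) for $k\ge n$: $(x\star_k y)\star_n z=x\star_n z$ and $x\star_k(y\star_n z)=x\star_k z$; (B4) for $k<n$: $(x\star_k y)\star_n z=x\star_k(y\star_n z)$; (B5) $\bar\sigma(\bar\tau(x))=\overline{\tau\circ\sigma}(x)$ and $\bar\iota(x)=x$; (B6) if $n\le k$, $\sigma$ is a permutation of $k$, and $f_i=x$ if $\sigma(i)<n$, $f_i=y$ otherwise ($0\le i<k$), then $\bar\sigma(x\star_n y)=((\dots(\bar\sigma(f_0)\star_1\bar\sigma(f_1))\star_2\dots)\star_{k-1}\bar\sigma(f_{k-1}))\star_k y$ (right-hand side read as $y$ if $k=0$); (B7) if $\sigma(i)=\tau(i)$ for all $m\le i<n$, then $(z\star_m\bar\sigma(x))\star_n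 y=(z\star_m\bar\tau(x))\star_n y$. A \emph{cm-monoid} is $\mathbf M=(M,\cdot,1,\star_n,\bar\sigma)_{n\in\omega,\sigma\in S_\omega}$ such that $(M,\cdot,1)$ is a monoid, $(M,\star_n,\bar\sigma)$ is a merge algebra, $(x\star_n y)\cdot z=(x\cdot z)\star_n(y\cdot z)$ for all $n$, and $\bar\sigma(x\cdot y)=\bar\sigma(x)\cdot y$ for all $\sigma\in S_\omega$. $\mathbb{CM}$ is the category of cm-monoids and homomorphisms. Put $M_{|1}=\{x\in M: x\star_1 1=x\}$ and $x[n]=\bar\tau^n_0(x)\star_1 1$. A \emph{clone algebra} is $\mathbf C=(C,q_n,\mathsf e_n)_{n\ge 0}$ with $\mathsf e_n\in C$ and $q_n$ of arity $n+1$ satisfying: (C1) $q_n(\mathsf e_i,x_0,\dots,x_{n-1})=x_i$ ($0\le i\le n-1$); (C2) $q_n(\mathsf e_j,x_0,\dots,x_{n-1})=\mathsf e_j$ ($j\ge n$); (C3) $q_n(x,\mathsf e_0,\dots,\mathsf e_{n-1})=x$; (C4) $q_n(x,\mathbf y)=q_k(x,\mathbf y,\mathsf e_n,\dots,\mathsf e_{k-1})$ ($k>n$); (C5) $q_n(q_n(x,y_0,\dots,y_{n-1}),\mathbf z)=q_n(x,q_n(y_0,\mathbf z),\dots,q_n(y_{n-1},\mathbf z))$. $\mathbb{CA}$ is the category of clone algebras and homomorphisms. The functor $(\_)^{\mathrm{cm}}$: for a clone algebra $\mathbf C$ let $1=(\mathsf e_0,\mathsf e_1,\dots)\in C^\omega$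 and $[1]_\equiv=\{s\in C^\omega: s_i\neq\mathsf e_i\text{ for only finitely many }i\}$. $\mathbf C^{\mathrm{cm}}$ has universe $[1]_\equiv$, unit $1$, $s\star_n u=(s_0,\dots,s_{n-1},u_n,u_{n+1},\dots)$, $\bar\sigma(s)=(s_{\sigma_i}:i\in\omega)$, and $b\cdot a=(q_k(b_i,a_0,\dots,a_{k-1}):i\in\omega)$ for any $k$ with $a_i=\mathsf e_i$ for all $i\ge k$ (independent of the choice of $k$). For $f:\mathbf C\to\mathbf B$, $f^{\mathrm{cm}}(a)=(f(a_i):i\in\omega)$. The functor $(\_)^{\mathrm{ca}}$: for a cm-monoid $\mathbf M$ and $b_0,\dots,b_{n-1}\in M_{|1}$, let $\widehat b_0=b_0$, $\widehat b_i=\widehat b_{i-1}\star_i\bar\tau^i_0(b_i)$ (and for $n=0$ read $\widehat b_{n-1}$ as $1$). $\mathbf M^{\mathrm{ca}}$ has universe $M_{|1}$, $\mathsf e_n=1[n]$ and $q_n(a,b_0,\dots,b_{n-1})=(a\cdot\widehat b_{n-1})\star_1 1$. For a morphism $g:\mathbf M\to\mathbf N$, $g^{\mathrm{ca}}$ is the restriction of $g$ to $M_{|1}\to N_{|1}$. *)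

(* Defs.v *)
From mathcomp Require Import all_boot.
From mathcomp Require Import zify.
From mathcomp Require Import boolp classical_sets functions cardinality.

Set Implicit Arguments.
Unset Strict Implicit.
Unset Printing Implicit Defensive.

Local Open Scope classical_set_scope.

Record category := Category {
  obj :> Type;
  hom : obj -> obj -> Type;
  idm : forall x, hom x x;
  cmp : forall x y z, hom y z -> hom x y -> hom x z;
  cmp1m : forall x y (f : hom x y), cmp (idm y) f = f;
  cmpm1 : forall x y (f : hom x y), cmp f (idm x) = f;
  cmpA : forall x y z t (h : hom z t) (g : hom y z) (f : hom x y),
    cmp h (cmp g f) = cmp (cmp h g) f }.

Arguments hom {_} _ _.
Arguments idm {_} _.
Arguments cmp {_ _ _ _} _ _.

Record functor (X Y : category) := Functor {
  fobj :> X -> Y;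
  fmap : forall x x' : X, hom x x' -> hom (fobj x) (fobj x');
  fmap1 : forall x, fmap (idm x) = idm (fobj x);
  fmapM : forall (x y z : X) (g : hom y z) (f : hom x y),
    fmap (cmp g f) = cmp (fmap g) (fmap f) }.

Arguments fmap {_ _} _ {_ _} _.

Definition left_adjoint (X Y : category) (F : functor X Y) (G : functor Y X)
    : Prop :=
  exists phi : forall (x : X) (y : Y), hom (F x) y -> hom x (G y),
    (forall x y, bijective (phi x y)) /\
    (forall (x x' : X) (y y' : Y) (f : hom x' x) (h : hom (F x) y)
            (g : hom y y'),
       phi x' y' (cmp (cmp g h) (fmap F f))
       = cmp (cmp (fmap G g) (phi x y h)) f).

Lemma finite_set_natP (P : nat -> Prop) :
  finite_set [set n | P n] <-> exists k, forall n, P n -> n < k.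
Proof.
split=> [/finite_seqP[s Ps]|[k Pk]]; last first.
  by apply: (sub_finite_set _ (finite_II k)) => n /Pk.
exists (\max_(i <- s) i).+1 => n Pn.
have sn : n \in s by have : [set n | P n] n by []; rewrite Ps.
by rewrite ltnS; apply: leq_bigmax_seq.
Qed.

Record fperm := FPerm {
  fperm_fun :> nat -> nat;
  fperm_bij : bijective fperm_fun;
  fperm_fin : finite_set [set n | fperm_fun n <> n] }.

Lemma fperm_eq (s t : fperm) : s =1 t -> s = t.
Proof.
case: s t => [s sb sf] [t tb tf] /= /funext st; subst t.
by congr FPerm; apply: Prop_irrelevance.
Qed.

Definition perm_of (s : fperm) (k : nat) : Prop :=
  [set n | s n <> n] `<=` `I_k.

Fact fperm_id_fin : finite_set [set n : nat | id n <> n].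
Proof. by apply/finite_set_natP; exists 0 => n []. Qed.

Definition fperm_id : fperm := FPerm (Bijective (frefl _) (frefl _)) fperm_id_fin.

Fact fperm_comp_fin (t s : fperm) : finite_set [set n | (t \o s) n <> n].
Proof.
have /finite_set_natP[k kt] := fperm_fin t.
have /finite_set_natP[l ls] := fperm_fin s.
apply/finite_set_natP; exists (maxn k l) => n /= tsn.
rewrite ltnNge geq_max; apply/negP => /andP[kn ln]; apply: tsn.
have sn : s n = n by apply: contrapT => /ls; rewrite ltnNge ln.
by rewrite sn; apply: contrapT => /kt; rewrite ltnNge kn.
Qed.

Definition fperm_comp (t s : fperm) : fperm :=
  FPerm (bij_comp (fperm_bij t) (fperm_bij s)) (fperm_comp_fin t s).

Definition transp0_fun (n i : nat) : nat :=
  if i == 0 then n else if i == n then 0 else i.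

Fact transp0_funK n : involutive (transp0_fun n).
Proof.
by move=> i; rewrite /transp0_fun; do !case: eqP => //; lia.
Qed.

Fact transp0_fin n : finite_set [set i | transp0_fun n i <> i].
Proof.
apply/finite_set_natP; exists n.+1 => i; rewrite /transp0_fun.
by case: (eqVneq i 0) => [->//|_]; case: (eqVneq i n) => [->|].
Qed.

Definition transp0 (n : nat) : fperm :=
  FPerm (inv_bij (transp0_funK n)) (transp0_fin n).

(* (... (f 0 *_1 f 1) *_2 ...) *_k f k *)
Fixpoint merge_chain (A : Type) (star : nat -> A -> A -> A) (f : nat -> A)
    (k : nat) : A :=
  if k is j.+1 then star k (merge_chain star f j) (f k) else f 0.

Record is_merge_algebra (A : Type) (star : nat -> A -> A -> A)
    (bar : fperm -> A -> A) : Prop := IsMergeAlgebra {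
  starA : forall n, associative (star n);
  starxx : forall n x, star n x x = x;
  star0 : forall x y, star 0 x y = y;
  star_geL : forall k n x y z, n <= k ->
    star n (star k x y) z = star n x z;
  star_geR : forall k n x y z, n <= k ->
    star k x (star n y z) = star k x z;
  star_lt : forall k n x y z, k < n ->
    star n (star k x y) z = star k x (star n y z);
  barM : forall s t x, bar s (bar t x) = bar (fperm_comp t s) x;
  bar1 : forall x, bar fperm_id x = x;
  bar_star : forall n k s x y, n <= k -> perm_of s k ->
    bar s (star n x y) =
      if k is j.+1 then
        star k (merge_chain star
                  (fun i => bar s (if s i < n then x else y)) j) y
      else y;
  bar_eq : forall m n (s t : fperm) x y z, (forall i, m <= i < n -> s i = t i) ->
    star n (star m z (bar s x)) y = star n (star m z (bar t x)) y }.

Record cm_monoid := CMMonoid {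
  cm_sort :> Type;
  cm_mul : cm_sort -> cm_sort -> cm_sort;
  cm_one : cm_sort;
  cm_star : nat -> cm_sort -> cm_sort -> cm_sort;
  cm_bar : fperm -> cm_sort -> cm_sort;
  cm_mulA : associative cm_mul;
  cm_mul1 : left_id cm_one cm_mul;
  cm_mulr1 : right_id cm_one cm_mul;
  cm_mergeP : is_merge_algebra cm_star cm_bar;
  cm_starM : forall n x y z,
    cm_mul (cm_star n x y) z = cm_star n (cm_mul x z) (cm_mul y z);
  cm_barM : forall s x y, cm_bar s (cm_mul x y) = cm_mul (cm_bar s x) y }.

Arguments cm_mul {_} _ _.
Arguments cm_one {_}.
Arguments cm_star {_} _ _ _.
Arguments cm_bar {_} _ _.

Record cm_hom (M N : cm_monoid) := CMHom {
  cm_fun :> M -> N;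
  cm_funM : forall x y, cm_fun (cm_mul x y) = cm_mul (cm_fun x) (cm_fun y);
  cm_fun1 : cm_fun cm_one = cm_one;
  cm_fun_star : forall n x y,
    cm_fun (cm_star n x y) = cm_star n (cm_fun x) (cm_fun y);
  cm_fun_bar : forall s x, cm_fun (cm_bar s x) = cm_bar s (cm_fun x) }.

Lemma cm_hom_eq (M N : cm_monoid) (f g : cm_hom M N) : f =1 g -> f = g.
Proof.
case: f g => [f f1 f2 f3 f4] [g g1 g2 g3 g4] /= /funext fg; subst g.
by congr CMHom; apply: Prop_irrelevance.
Qed.

Definition cm_idm (M : cm_monoid) : cm_hom M M.
Proof. by exists id. Defined.

Definition cm_cmp (M N P : cm_monoid) (g : cm_hom N P) (f : cm_hom M N) :
  cm_hom M P.
Proof.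
exists (g \o f) => /=.
- by move=> x y; rewrite !cm_funM.
- by rewrite !cm_fun1.
- by move=> n x y; rewrite !cm_fun_star.
- by move=> s x; rewrite !cm_fun_bar.
Defined.

Definition CM : category.
Proof.
by exists cm_monoid cm_hom cm_idm cm_cmp => *; apply: cm_hom_eq.
Defined.

(* [y 0, ..., y (n - 1), e n, ..., e (k - 1)] *)
Definition ext_args (C : Type) (e : nat -> C) (n k : nat) (y : 'I_n -> C) :
  'I_k -> C := fun i => oapp y (e i) (insub (val i)).

Record clone_algebra := CloneAlgebra {
  ca_sort :> Type;
  ca_q : forall n, ca_sort -> ('I_n -> ca_sort) -> ca_sort;
  ca_e : nat -> ca_sort;
  ca_qe : forall n (i : 'I_n) x, ca_q (ca_e i) x = x i;
  ca_qe_ge : forall n j (x : 'I_n -> ca_sort), n <= j ->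
    ca_q (ca_e j) x = ca_e j;
  ca_q_id : forall n x, ca_q x (fun i : 'I_n => ca_e i) = x;
  ca_q_ext : forall n k x (y : 'I_n -> ca_sort), n < k ->
    ca_q x y = ca_q x (ext_args ca_e (k := k) y);
  ca_qq : forall n x (y z : 'I_n -> ca_sort),
    ca_q (ca_q x y) z = ca_q x (fun i => ca_q (y i) z) }.

Arguments ca_q {_ _} _ _.
Arguments ca_e {_} _.

Record ca_hom (B C : clone_algebra) := CAHom {
  ca_fun :> B -> C;
  ca_fun_q : forall n x (y : 'I_n -> B),
    ca_fun (ca_q x y) = ca_q (ca_fun x) (fun i => ca_fun (y i));
  ca_fun_e : forall n, ca_fun (ca_e n) = ca_e n }.

Lemma ca_hom_eq (B C : clone_algebra) (f g : ca_hom B C) : f =1 g -> f = g.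
Proof.
case: f g => [f f1 f2] [g g1 g2] /= /funext fg; subst g.
by congr CAHom; apply: Prop_irrelevance.
Qed.

Definition ca_idm (C : clone_algebra) : ca_hom C C.
Proof. by exists id. Defined.

Definition ca_cmp (B C D : clone_algebra) (g : ca_hom C D) (f : ca_hom B C) :
  ca_hom B D.
Proof.
exists (g \o f) => /=.
- by move=> n x y; rewrite !ca_fun_q.
- by move=> n; rewrite !ca_fun_e.
Defined.

Definition CA : category.
Proof.
by exists clone_algebra ca_hom ca_idm ca_cmp => *; apply: ca_hom_eq.
Defined.

Section CloneToCM.
Variable C : clone_algebra.

Definition fin_e (s : nat -> C) : Prop := finite_set [set i | s i <> ca_e i].

Definition cm_carrier : Type := {s : nat -> C | fin_e s}.

Implicit Types (s u : nat -> C) (a b : cm_carrier).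

Lemma fin_eP s : fin_e s <-> exists k, forall i, k <= i -> s i = ca_e i.
Proof.
rewrite /fin_e; split=> [/finite_set_natP|] [k sk].
  by exists k => i ki; apply: contrapT => /sk; rewrite ltnNge ki.
apply/finite_set_natP; exists k => i /= si; rewrite ltnNge; apply/negP => ki.
exact/si/sk.
Qed.

Lemma cm_carrier_eq a b : sval a =1 sval b -> a = b.
Proof. by case: a b => [a fa] [b fb] /= /funext ab; apply: eq_exist. Qed.

Lemma cm_carrier_bound a : exists k, forall i, k <= i -> sval a i = ca_e i.
Proof. exact/fin_eP/(svalP a). Qed.

Definition cm_bound a : nat := sval (cid (cm_carrier_bound a)).

Lemma cm_boundP a i : cm_bound a <= i -> sval a i = ca_e i.
Proof. exact: (svalP (cid (cm_carrier_bound a))). Qed.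

Fact cm_one_fin : fin_e (@ca_e C).
Proof. by apply/fin_eP; exists 0. Qed.

Definition cmC_one : cm_carrier := exist _ _ cm_one_fin.

Definition seq_star n s u : nat -> C := fun i => if i < n then s i else u i.

Fact seq_star_fin n a b : fin_e (seq_star n (sval a) (sval b)).
Proof.
apply/fin_eP; exists (maxn n (cm_bound b)) => i; rewrite geq_max.
by case/andP=> ni bi; rewrite /seq_star ltnNge ni /= cm_boundP.
Qed.

Definition cmC_star n a b : cm_carrier := exist _ _ (seq_star_fin n a b).

Fact seq_bar_fin (s : fperm) a : fin_e (fun i => sval a (s i)).
Proof.
have /finite_set_natP[k ks] := fperm_fin s.
apply/fin_eP; exists (maxn k (cm_bound a)) => i; rewrite geq_max.
case/andP=> ki ai; have -> : s i = i.
  by apply: contrapT => /ks; rewrite ltnNge ki.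
exact: cm_boundP.
Qed.

Definition cmC_bar (s : fperm) a : cm_carrier := exist _ _ (seq_bar_fin s a).

Definition seq_mul k b a : nat -> C :=
  fun i => ca_q (sval b i) (fun j : 'I_k => sval a j).

(* Independence of the choice of [k] in the definition of the product. *)
Lemma ca_q_bound k l a x : (forall i, k <= i -> sval a i = ca_e i) -> k <= l ->
  ca_q x (fun j : 'I_k => sval a j) = ca_q x (fun j : 'I_l => sval a j).
Proof.
move=> ak; rewrite leq_eqVlt => /predU1P[<-//|kl].
rewrite (ca_q_ext _ _ kl); congr ca_q; apply: funext => j; rewrite /ext_args.
by case: insubP => [i _ <-//|]; rewrite -leqNgt => /ak.
Qed.

Lemma seq_mul_indep k l b a :
    (forall i, k <= i -> sval a i = ca_e i) ->
    (forall i, l <= i -> sval a i = ca_e i) ->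
  seq_mul k b a = seq_mul l b a.
Proof.
move=> ak al; apply: funext => i; rewrite /seq_mul.
by rewrite (ca_q_bound _ ak (leq_maxl k l)) (ca_q_bound _ al (leq_maxr k l)).
Qed.

Fact seq_mul_fin b a : fin_e (seq_mul (cm_bound a) b a).
Proof.
apply/fin_eP; exists (maxn (cm_bound b) (cm_bound a)) => i; rewrite geq_max.
by case/andP=> bi ai; rewrite /seq_mul (cm_boundP bi) ca_qe_ge.
Qed.

Definition cmC_mul b a : cm_carrier := exist _ _ (seq_mul_fin b a).

Lemma cmC_mulE k b a : (forall i, k <= i -> sval a i = ca_e i) ->
  sval (cmC_mul b a) = seq_mul k b a.
Proof. by move=> ak; apply: seq_mul_indep => // i; apply: cm_boundP. Qed.

Fact cmC_mulA : associative cmC_mul.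
Proof.
move=> c b a; apply: cm_carrier_eq => i.
pose k := maxn (cm_bound b) (cm_bound a).
have bk j : k <= j -> sval b j = ca_e j.
  by move=> kj; apply/cm_boundP/(leq_trans _ kj)/leq_maxl.
have ak j : k <= j -> sval a j = ca_e j.
  by move=> kj; apply/cm_boundP/(leq_trans _ kj)/leq_maxr.
have bak j : k <= j -> sval (cmC_mul b a) j = ca_e j.
  by move=> kj; rewrite (cmC_mulE _ ak) /seq_mul bk // ca_qe_ge.
rewrite (cmC_mulE _ bak) (cmC_mulE _ ak) /seq_mul (cmC_mulE _ bk) /seq_mul.
rewrite ca_qq; congr ca_q; apply: funext => j.
by rewrite (cmC_mulE _ ak).
Qed.

Fact cmC_mul1 : left_id cmC_one cmC_mul.
Proof.
move=> a; apply: cm_carrier_eq => i; pose k := maxn i.+1 (cm_bound a).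
have ak j : k <= j -> sval a j = ca_e j.
  by move=> kj; apply/cm_boundP/(leq_trans _ kj)/leq_maxr.
have ik : i < k by exact: leq_maxl.
by rewrite (cmC_mulE _ ak) /seq_mul (ca_qe (Ordinal ik)).
Qed.

Fact cmC_mulr1 : right_id cmC_one cmC_mul.
Proof.
move=> a; apply: cm_carrier_eq => i.
by rewrite (@cmC_mulE 0) // /seq_mul ca_q_id.
Qed.

Lemma cmC_chainE (f : nat -> cm_carrier) k i :
  sval (merge_chain cmC_star f k) i = sval (f (minn i k)) i.
Proof.
elim: k => [|k IHk] /=; first by rewrite minn0.
by rewrite /seq_star IHk; case: ltnP => // ik; rewrite (minn_idPl _).
Qed.

Fact cmC_mergeP : is_merge_algebra cmC_star cmC_bar.
Proof.
split.
- move=> n x y z; apply: cm_carrier_eq => i /=; rewrite /seq_star /=.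
  by case: ltnP; rewrite // /seq_star => ->.
- by move=> n x; apply: cm_carrier_eq => i /=; rewrite /seq_star if_same.
- by move=> x y; apply: cm_carrier_eq => i.
- move=> k n x y z nk; apply: cm_carrier_eq => i /=; rewrite /seq_star /=.
  by case: ltnP; rewrite // /seq_star => /leq_trans ->.
- move=> k n x y z nk; apply: cm_carrier_eq => i /=; rewrite /seq_star /=.
  case: (ltnP i k) => // ki; rewrite /seq_star.
  by rewrite ltnNge (leq_trans nk ki).
- move=> k n x y z kn; apply: cm_carrier_eq => i /=; rewrite /seq_star /=.
  rewrite /seq_star; case: (ltnP i n) => // ni; rewrite ltnNge.
  by rewrite (leq_trans (ltnW kn) ni).
- by move=> s t x; apply: cm_carrier_eq.
- by move=> x; apply: cm_carrier_eq.
- move=> n k s x y nk sk; apply: cm_carrier_eq => i /=.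
  have sE j : k <= j -> s j = j.
    by move=> kj; apply: contrapT => /sk /=; rewrite ltnNge kj.
  rewrite {1}/seq_star; case: k => [|k] in nk sk sE *.
    by rewrite sE // ltnNge (leq_trans nk).
  rewrite /= /seq_star cmC_chainE; case: (ltnP i k.+1) => ik; last first.
    by rewrite sE // ltnNge (leq_trans nk ik).
  by rewrite (minn_idPl _) //=; case: ifP.
- move=> m n s t x y z st; apply: cm_carrier_eq => i /=; rewrite /seq_star /=.
  rewrite /seq_star; case: ltnP => // ni; case: (ltnP i m) => // mi.
  by rewrite st // mi.
Qed.

Fact cmC_starM n x y z :
  cmC_mul (cmC_star n x y) z = cmC_star n (cmC_mul x z) (cmC_mul y z).
Proof.
apply: cm_carrier_eq => i /=; rewrite /seq_mul /= /seq_star.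
by case: ifP.
Qed.

Fact cmC_barM (s : fperm) x y : cmC_bar s (cmC_mul x y) = cmC_mul (cmC_bar s x) y.
Proof. exact: cm_carrier_eq. Qed.

Definition cm_of_ca : cm_monoid :=
  CMMonoid cmC_mulA cmC_mul1 cmC_mulr1 cmC_mergeP cmC_starM cmC_barM.

End CloneToCM.

Section CloneToCMMap.
Variables (B C : clone_algebra) (f : ca_hom B C).

Fact cm_map_fin (a : cm_carrier B) : fin_e (fun i => f (sval a i)).
Proof.
by apply/fin_eP; exists (cm_bound a) => i ai; rewrite cm_boundP // ca_fun_e.
Qed.

Definition cm_map (a : cm_of_ca B) : cm_of_ca C := exist _ _ (cm_map_fin a).

Definition cm_map_hom : cm_hom (cm_of_ca B) (cm_of_ca C).
Proof.
exists cm_map.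
- move=> b a; apply: cm_carrier_eq => i /=.
  have ak j : cm_bound a <= j -> sval (cm_map a) j = ca_e j.
    by move=> kj /=; rewrite cm_boundP // ca_fun_e.
  by rewrite [RHS](congr1 (@^~ i) (cmC_mulE _ ak)) /seq_mul ca_fun_q.
- by apply: cm_carrier_eq => i /=; rewrite ca_fun_e.
- by move=> n x y; apply: cm_carrier_eq => i /=; rewrite /seq_star /=; case: ifP.
- by move=> s x; apply: cm_carrier_eq.
Defined.

End CloneToCMMap.

Definition cm_functor : functor CA CM.
Proof.
exists (cm_of_ca : CA -> CM) cm_map_hom.
- by move=> C; apply: cm_hom_eq => a; apply: cm_carrier_eq.
- by move=> B C D g f; apply: cm_hom_eq => a; apply: cm_carrier_eq.
Defined.

(* [x[n]] *)
Definition cm_coord (M : cm_monoid) (n : nat) (x : M) : M :=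
  cm_star 1 (cm_bar (transp0 n) x) cm_one.

Fixpoint cm_hat_nat (M : cm_monoid) (b : nat -> M) (i : nat) : M :=
  if i is j.+1 then cm_star i (cm_hat_nat b j) (cm_bar (transp0 i) (b i))
  else b 0.

(* [cm_hat b] is the last term of the recursion over [b 0, ..., b (n - 1)],
   or the unit if [n = 0]. *)
Definition cm_hat (M : cm_monoid) (n : nat) : ('I_n -> M) -> M :=
  if n is n'.+1 then fun b => cm_hat_nat (fun i => b (inord i)) n'
  else fun=> cm_one.

Section Coordinates.
Variable M : cm_monoid.
Let MP := cm_mergeP M.
Implicit Types x y z : M.

Lemma transp0_perm_of n k : n < k -> perm_of (transp0 n) k.
Proof.
move=> nk i; rewrite /= /transp0_fun.
case: (eqVneq i 0) => [->|_]; first by move=> _; apply: leq_trans nk.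
by case: (eqVneq i n) => [->|].
Qed.

Lemma bar_head (s t : fperm) x y : s 0 = t 0 ->
  cm_star 1 (cm_bar s x) y = cm_star 1 (cm_bar t x) y.
Proof.
move=> st; have := bar_eq MP (m := 0) (n := 1) (s := s) (t := t) x y x.
by rewrite !(star0 MP); apply; case.
Qed.

Lemma cm_coord_star i n x y :
  cm_coord i (cm_star n x y) = if i < n then cm_coord i x else cm_coord i y.
Proof.
rewrite /cm_coord; pose k := maxn n i.
have nk : n <= k.+1 by rewrite ltnW // ltnS leq_maxl.
have ik : i < k.+1 by rewrite ltnS leq_maxr.
rewrite (bar_star MP x y nk (transp0_perm_of ik)) (star_geL MP) //.
elim: (k) => [|j IHj] /=; last by rewrite (star_geL MP).
by rewrite [transp0_fun i 0]/transp0_fun eqxx; case: ifP.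
Qed.

Lemma cm_coord_bar i (s : fperm) x : cm_coord i (cm_bar s x) = cm_coord (s i) x.
Proof. by rewrite /cm_coord (barM MP); apply: bar_head. Qed.

Lemma cm_coord_mul i x y :
  cm_coord i (cm_mul x y) = cm_star 1 (cm_mul (cm_coord i x) y) cm_one.
Proof. by rewrite /cm_coord cm_starM -(cm_barM _ x y) (star_geL MP). Qed.

Lemma bar_transp0K n : involutive (@cm_bar M (transp0 n)).
Proof.
move=> x; rewrite (barM MP) -[RHS](bar1 MP); congr cm_bar.
by apply: fperm_eq => i /=; apply: transp0_funK.
Qed.

Lemma bar_transp0_id x : cm_bar (transp0 0) x = x.
Proof.
rewrite -[RHS](bar1 MP); congr cm_bar; apply: fperm_eq => i /=.
by rewrite /transp0_fun; case: eqP.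
Qed.

Lemma bar_transp0_star n (u v : M) : exists w, cm_bar (transp0 n) (cm_star 1 u v)
  = cm_star n.+1 (cm_star n w (cm_bar (transp0 n) u)) v.
Proof.
have fn : transp0_fun n n = 0 by rewrite /transp0_fun eqxx; case: eqP.
rewrite (bar_star MP u v (ltn0Sn n) (transp0_perm_of (ltnSn n))).
case: n fn => [|n] fn /=; last by rewrite fn; eexists.
by exists u; rewrite (star0 MP).
Qed.

Lemma star_coord n x y z :
  cm_star n.+1 (cm_star n z (cm_bar (transp0 n) (cm_coord n x))) y
  = cm_star n.+1 (cm_star n z x) y.
Proof.
rewrite /cm_coord; have [w ->] := bar_transp0_star n (cm_bar (transp0 n) x) cm_one.
rewrite bar_transp0K -(star_lt MP _ _ _ (ltnSn n)) (star_geL MP) //.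
by rewrite (star_geR MP).
Qed.

Lemma star_coord_inj n x y z : (forall i, i < n -> cm_coord i x = cm_coord i y) ->
  cm_star n x z = cm_star n y z.
Proof.
elim: n z => [|n IHn] z xy; first by rewrite !(star0 MP).
rewrite -[in LHS](starxx MP n x) -[in RHS](starxx MP n y).
rewrite -(star_coord n x) -(star_coord n y) xy //.
by congr cm_star; apply: IHn => i /ltnW /xy.
Qed.

Lemma cm_coord_M1 i x : cm_star 1 x cm_one = x ->
  cm_coord i x = if i is 0 then x else cm_coord i cm_one.
Proof.
move=> x1; case: i => [|i]; first by rewrite /cm_coord bar_transp0_id.
by rewrite -x1 cm_coord_star.
Qed.

Section HatNat.
Variable b : nat -> M.
Hypothesis b1 : forall i, cm_star 1 (b i) cm_one = b i.

Lemma cm_hat_nat_coord m i :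
  cm_coord i (cm_hat_nat b m) = if i <= m then b i else cm_coord i cm_one.
Proof.
elim: m => [|m IHm] /=; first by rewrite cm_coord_M1 //; case: i.
rewrite cm_coord_star cm_coord_bar IHm ltnS.
case: (ltngtP i m.+1) => [|mi|->].
- by rewrite ltnS => ->.
- rewrite leqNgt (ltnW mi) /= /transp0_fun (gtn_eqF mi).
  by case: i mi {IHm} => [//|i] _; rewrite cm_coord_M1.
- by rewrite ltnn /= /transp0_fun eqxx cm_coord_M1.
Qed.

Lemma cm_hat_nat_tail m : cm_star m.+1 (cm_hat_nat b m) cm_one = cm_hat_nat b m.
Proof.
case: m => [|m] /=; first exact: b1.
rewrite (star_lt MP) // -[b m.+1]b1.
have [w ->] := bar_transp0_star m.+1 (b m.+1) cm_one.
by rewrite (star_geL MP).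
Qed.

End HatNat.

Lemma cm_hat_tail n (b : 'I_n -> M) :
  (forall i, cm_star 1 (b i) cm_one = b i) ->
  cm_star n (cm_hat b) cm_one = cm_hat b.
Proof.
case: n b => [|n] b b1; first by rewrite (star0 MP).
by apply: cm_hat_nat_tail => i.
Qed.

Lemma cm_hat_coord n (b : 'I_n -> M) :
  (forall i, cm_star 1 (b i) cm_one = b i) ->
  forall i, cm_coord i (cm_hat b) = oapp b (cm_coord i cm_one) (insub i).
Proof.
case: n b => [|n] b b1 i; first by rewrite insubF.
rewrite [cm_hat b]/= cm_hat_nat_coord // -ltnS.
case: insubP => [j -> <- /=|/negbTE -> //]; by rewrite inord_val.
Qed.

Lemma cm_hat_uniq n (b : 'I_n -> M) x :
  (forall i, cm_star 1 (b i) cm_one = b i) ->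
  cm_star n x cm_one = x -> (forall i : 'I_n, cm_coord i x = b i) ->
  cm_hat b = x.
Proof.
move=> b1 xn xb; rewrite -xn -(cm_hat_tail b1); apply: star_coord_inj => i ni.
by rewrite cm_hat_coord // insubT /= -xb.
Qed.

End Coordinates.

Section CMToClone.
Variable M : cm_monoid.
Let MP := cm_mergeP M.

(* [M_{|1}] *)
Definition ca_carrier : Type := {x : M | cm_star 1 x cm_one = x}.

Implicit Types x : ca_carrier.

Lemma ca_carrier_eq (x y : ca_carrier) : sval x = sval y -> x = y.
Proof. by case: x y => [x x1] [y y1] /= xy; apply: eq_exist. Qed.

Fact star1_one (x : M) : cm_star 1 (cm_star 1 x cm_one) cm_one = cm_star 1 x cm_one.
Proof. exact: (star_geL MP). Qed.

Definition caM_e n : ca_carrier :=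
  exist _ (cm_coord n cm_one) (star1_one (cm_bar (transp0 n) cm_one)).

Definition caM_q n (a : ca_carrier) (b : 'I_n -> ca_carrier) : ca_carrier :=
  exist _ _ (star1_one (cm_mul (sval a) (cm_hat (fun i => sval (b i))))).

Lemma caM_q_coord n (i : nat) (x : 'I_n -> ca_carrier) :
  sval (caM_q (caM_e i) x) = cm_coord i (cm_hat (fun i => sval (x i))).
Proof. by rewrite /= -cm_coord_mul cm_mul1. Qed.

Fact caM_qe n (i : 'I_n) (x : 'I_n -> ca_carrier) : caM_q (caM_e i) x = x i.
Proof.
apply: ca_carrier_eq; rewrite caM_q_coord cm_hat_coord ?valK //.
by move=> j; apply: (svalP (x j)).
Qed.

Fact caM_qe_ge n j (x : 'I_n -> ca_carrier) : n <= j ->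
  caM_q (caM_e j) x = caM_e j.
Proof.
move=> nj; apply: ca_carrier_eq; rewrite caM_q_coord cm_hat_coord.
  by rewrite insubF // ltnNge nj.
by move=> i; apply: (svalP (x i)).
Qed.

Fact caM_q_id n x : caM_q x (fun i : 'I_n => caM_e i) = x.
Proof.
apply: ca_carrier_eq => /=; rewrite (@cm_hat_uniq _ _ _ cm_one) //.
- by rewrite cm_mulr1 (svalP x).
- by move=> i; apply: star1_one.
- exact: (starxx MP).
Qed.

Fact caM_q_ext n k x (y : 'I_n -> ca_carrier) : n < k ->
  caM_q x y = caM_q x (ext_args caM_e (k := k) y).
Proof.
move=> nk; apply: ca_carrier_eq => /=; congr (cm_star _ (cm_mul _ _) _).
have y1 i : cm_star 1 (sval (y i)) cm_one = sval (y i) by apply: (svalP (y i)).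
apply/esym/cm_hat_uniq => [i||i].
- exact: (svalP (ext_args caM_e y i)).
- by rewrite -(cm_hat_tail y1) (star_lt MP) // (starxx MP).
- by rewrite cm_hat_coord // /ext_args; case: insub.
Qed.

Fact caM_qq n x (y z : 'I_n -> ca_carrier) :
  caM_q (caM_q x y) z = caM_q x (fun i => caM_q (y i) z).
Proof.
have y1 i : cm_star 1 (sval (y i)) cm_one = sval (y i) by apply: (svalP (y i)).
have z1 i : cm_star 1 (sval (z i)) cm_one = sval (z i) by apply: (svalP (z i)).
apply: ca_carrier_eq => /=.
rewrite cm_starM cm_mul1 (star_geL MP) // -cm_mulA.
congr (cm_star _ (cm_mul _ _) _); apply/esym/cm_hat_uniq => [i||i].
- exact: star1_one.
- rewrite -(cm_hat_tail y1) cm_starM cm_mul1 -(starA MP).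
  by rewrite (cm_hat_tail z1).
- by rewrite cm_coord_mul cm_hat_coord // valK.
Qed.

Definition ca_of_cm : clone_algebra :=
  CloneAlgebra caM_qe caM_qe_ge caM_q_id caM_q_ext caM_qq.

End CMToClone.

Section CMToCloneMap.
Variables (M N : cm_monoid) (g : cm_hom M N).

Fact ca_map_subproof (x : ca_carrier M) :
  cm_star 1 (g (sval x)) cm_one = g (sval x).
Proof. by rewrite -(cm_fun1 g) -cm_fun_star (svalP x). Qed.

Definition ca_map (x : ca_of_cm M) : ca_of_cm N :=
  exist _ _ (ca_map_subproof x).

Lemma cm_fun_hat n (b : 'I_n -> M) : g (cm_hat b) = cm_hat (fun i => g (b i)).
Proof.
case: n b => [|n] b /=; first exact: cm_fun1.
have cm_fun_hat_nat c m : g (cm_hat_nat c m) = cm_hat_nat (fun i => g (c i)) m.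
  by elim: m => [//|m IHm] /=; rewrite cm_fun_star cm_fun_bar IHm.
exact: cm_fun_hat_nat.
Qed.

Definition ca_map_hom : ca_hom (ca_of_cm M) (ca_of_cm N).
Proof.
exists ca_map.
- move=> n x y; apply: ca_carrier_eq => /=.
  by rewrite cm_fun_star cm_funM cm_fun1 cm_fun_hat.
- move=> n; apply: ca_carrier_eq => /=.
  by rewrite /cm_coord cm_fun_star cm_fun_bar cm_fun1.
Defined.

End CMToCloneMap.

Definition ca_functor : functor CM CA.
Proof.
exists (ca_of_cm : CM -> CA) ca_map_hom.
- by move=> M; apply: ca_hom_eq => x; apply: ca_carrier_eq.
- by move=> M N P g f; apply: ca_hom_eq => x; apply: ca_carrier_eq.
Defined.

(* Main.v *)
Require Import Defs.
From mathcomp Require Import all_boot.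
From mathcomp Require Import boolp.

(** The unit sends [c] in [C] to [(c, e_1, e_2, ...)].  Call [x] in a cm-monoid
    finite-dimensional when [x *_n 1 = x] for some [n].  Such an element is
    determined by its coordinates [x[i]]; every element of the image of a
    morphism out of [C^cm] is finite-dimensional, and the coordinates of the
    image of [a] are the images of the [a i] under the transposed morphism.
    Conversely, [g : C -> M^ca] extends to [C^cm] by sending [a] to the element
    of [M] with coordinates [g (a i)], and the homomorphism laws are checked
    coordinatewise. *)

Set Implicit Arguments.
Unset Strict Implicit.
Unset Printing Implicit Defensive.

Definition findim (M : cm_monoid) (x : M) : Prop :=
  exists n, cm_star n x cm_one = x.

Section FiniteDimensional.
Variable M : cm_monoid.
Let MP := cm_mergeP M.
Implicit Types x y : M.

Lemma cm_star_one_le n k x : n <= k -> cm_star n x cm_one = x ->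
  cm_star k x cm_one = x.
Proof.
rewrite leq_eqVlt => /predU1P[<-//|nk] xn.
by rewrite -xn (star_lt MP) // (starxx MP).
Qed.

(** The margin [m] puts the common dimension above a prescribed index, as [star_lt] requires in
    [findim_star]. *)
Lemma findim2 x y m : findim x -> findim y ->
  exists k, [/\ m < k, cm_star k x cm_one = x & cm_star k y cm_one = y].
Proof.
move=> [n xn] [l yl]; exists (maxn m.+1 (maxn n l)); split.
- exact: leq_maxl.
- by apply: cm_star_one_le xn; rewrite leq_max leq_maxl orbT.
- by apply: cm_star_one_le yl; rewrite leq_max leq_maxr orbT.
Qed.

Lemma findim_coord_inj x y : findim x -> findim y ->
  (forall i, cm_coord i x = cm_coord i y) -> x = y.
Proof.
move=> fx fy xy; have [k [_ <- <-]] := findim2 0 fx fy.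
exact: star_coord_inj.
Qed.

Lemma findim_one : findim (@cm_one M).
Proof. by exists 0; rewrite (starxx MP). Qed.

Lemma findim_star n x y : findim y -> findim (cm_star n x y).
Proof.
move=> fy; have [k [nk yk _]] := findim2 n fy fy.
by exists k; rewrite (star_lt MP) // yk.
Qed.

(** Replacing [x] by [x *_k 1] and distributing gives [x y = (x y) *_k y], whose right factor
    absorbs [*_k 1]. *)
Lemma findim_mul x y : findim x -> findim y -> findim (cm_mul x y).
Proof.
move=> fx fy; have [k [_ xk yk]] := findim2 0 fx fy.
by exists k; rewrite -xk cm_starM cm_mul1 -(starA MP) yk.
Qed.

Lemma findim_bar (s : fperm) x : findim x -> findim (cm_bar s x).
Proof.
move=> [n xn]; have /finite_set_natP[k sk] := fperm_fin s.
(* The index [l.+1] bounds both [n] and the support of [s], and lies in the nonzero case of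
   [bar_star], where the result ends in [*_(l.+1) 1]. *)
pose l := (maxn n k).
have nl : n <= l.+1 by rewrite ltnW // ltnS leq_maxl.
have sl : perm_of s l.+1.
  by move=> i /sk /= ik; rewrite ltnS (leq_trans (ltnW ik)) ?leq_maxr.
by exists l.+1; rewrite -xn (bar_star MP _ _ nl sl) -(starA MP) (starxx MP).
Qed.

Lemma findim_hat n (b : 'I_n -> M) :
  (forall i, cm_star 1 (b i) cm_one = b i) -> findim (cm_hat b).
Proof. by move=> b1; exists n; apply: cm_hat_tail. Qed.

End FiniteDimensional.

Lemma cm_fun_coord (M N : cm_monoid) (h : cm_hom M N) i (x : M) :
  h (cm_coord i x) = cm_coord i (h x).
Proof. by rewrite /cm_coord cm_fun_star cm_fun_bar cm_fun1. Qed.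

Lemma cm_fun_findim (M N : cm_monoid) (h : cm_hom M N) (x : M) :
  findim x -> findim (h x).
Proof. by move=> [n xn]; exists n; rewrite -(cm_fun1 h) -cm_fun_star xn. Qed.

Section Unit.
Variable C : clone_algebra.

Lemma findim_cm_of_ca (a : cm_of_ca C) : findim a.
Proof.
exists (cm_bound a); apply: cm_carrier_eq => i /=; rewrite /seq_star.
by case: ltnP => // ai; rewrite cm_boundP.
Qed.

Lemma cm_coord0 i (a : cm_of_ca C) : sval (cm_coord i a) 0 = sval a i.
Proof. by []. Qed.

Fact unit_seq_fin (c : C) : fin_e (fun i => if i is 0 then c else ca_e i).
Proof. by apply/fin_eP; exists 1; case. Qed.

Definition unit_seq (c : C) : cm_of_ca C := exist _ _ (unit_seq_fin c).

Fact unit_seq_star1 c : cm_star 1 (unit_seq c) cm_one = unit_seq c.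
Proof. by apply: cm_carrier_eq; case. Qed.

Lemma unit_seq_coord i (a : cm_of_ca C) : cm_coord i a = unit_seq (sval a i).
Proof. by apply: cm_carrier_eq; case. Qed.

Definition unit_map (c : C) : ca_of_cm (cm_of_ca C) :=
  exist _ _ (unit_seq_star1 c).

Definition unit_hom : ca_hom C (ca_of_cm (cm_of_ca C)).
Proof.
exists unit_map.
- move=> n x y; apply/ca_carrier_eq/cm_carrier_eq => -[|//].
  set b := cm_hat (fun i => unit_seq (y i)).
  have bE i : sval b i = oapp y (ca_e i) (insub i).
    rewrite -cm_coord0 cm_hat_coord => [|j]; last exact: unit_seq_star1.
    by case: insub.
  (* Since [n] bounds [b], the product can be computed with arity [n] instead of the chosen
     [cm_bound b]. *)
  have bn i : n <= i -> sval b i = ca_e i.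
    by move=> ni; rewrite bE insubF // ltnNge ni.
  rewrite /= /seq_star /= [RHS](congr1 (@^~ 0) (cmC_mulE _ bn)) /seq_mul /=.
  by congr ca_q; apply: funext => i; rewrite bE valK.
- by move=> n; apply: ca_carrier_eq; apply/esym/unit_seq_coord.
Defined.

End Unit.

Definition transpose (C : clone_algebra) (M : cm_monoid)
    (h : cm_hom (cm_of_ca C) M) : ca_hom C (ca_of_cm M) :=
  ca_cmp (ca_map_hom h) (unit_hom C).

Section Extension.
Variables (C : clone_algebra) (M : cm_monoid) (g : ca_hom C (ca_of_cm M)).
Implicit Types a b : cm_of_ca C.

Let g1 c : cm_star 1 (sval (g c)) cm_one = sval (g c).
Proof. exact: svalP (g c). Qed.

(** The choice of bound is harmless: [ext_map_coord] does not depend on it. *)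
Definition ext_map a : M :=
  cm_hat (fun i : 'I_(cm_bound a) => sval (g (sval a i))).

Lemma ext_map_findim a : findim (ext_map a).
Proof. exact: findim_hat. Qed.

Lemma ext_map_coord i a : cm_coord i (ext_map a) = sval (g (sval a i)).
Proof.
rewrite cm_hat_coord //; case: insubP => [j _ <- //|].
(* Past the bound the hat has the coordinates of [cm_one], which are the constants [ca_e i] of
   [ca_of_cm M]. *)
by rewrite -leqNgt => ai; rewrite cm_boundP // ca_fun_e.
Qed.

Definition ext_hom : cm_hom (cm_of_ca C) M.
Proof.
exists ext_map.
- move=> b a; apply: findim_coord_inj => [||i].
  + exact: ext_map_findim.
  + by apply: findim_mul; apply: ext_map_findim.
  (* The product uses arity [cm_bound a], so the hat inside [ca_q] of [ca_of_cm M] is exactly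
     [ext_map a]. *)
  + by rewrite cm_coord_mul !ext_map_coord /= /seq_mul ca_fun_q.
- apply: findim_coord_inj => [||i].
  + exact: ext_map_findim.
  + exact: findim_one.
  + by rewrite ext_map_coord ca_fun_e.
- move=> n a b; apply: findim_coord_inj => [||i].
  + exact: ext_map_findim.
  + by apply: findim_star; apply: ext_map_findim.
  + by rewrite cm_coord_star !ext_map_coord /= /seq_star; case: ifP.
- move=> s a; apply: findim_coord_inj => [||i].
  + exact: ext_map_findim.
  + by apply: findim_bar; apply: ext_map_findim.
  + by rewrite cm_coord_bar !ext_map_coord.
Defined.

End Extension.

Lemma transposeK (C : clone_algebra) (M : cm_monoid) :
  cancel (@transpose C M) (@ext_hom C M).
Proof.
move=> h; apply: cm_hom_eq => a; apply: findim_coord_inj => [||i].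
- exact: ext_map_findim.
- exact/cm_fun_findim/findim_cm_of_ca.
- by rewrite ext_map_coord -cm_fun_coord unit_seq_coord.
Qed.

Lemma ext_homK (C : clone_algebra) (M : cm_monoid) :
  cancel (@ext_hom C M) (@transpose C M).
Proof.
move=> g; apply: ca_hom_eq => c; apply: ca_carrier_eq.
(* An element fixed by [*_1 1] is its own coordinate at 0. *)
have /= <- := cm_coord_M1 0 (svalP (transpose (ext_hom g) c)).
by rewrite ext_map_coord.
Qed.

Theorem theorem6p10 : left_adjoint cm_functor ca_functor.
Proof.
exists transpose; split=> [C M|C C' M M' f h g].
  exact: Bijective (@transposeK C M) (@ext_homK C M).
apply: ca_hom_eq => c; apply: ca_carrier_eq => /=; congr (g (h _)).
(* What remains is naturality of the unit in [f]. *)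
by apply: cm_carrier_eq => -[|i] //=; rewrite ca_fun_e.
Qed.
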